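(* There exist universal constants $\mu_3>0$ and $0<\nu_3<1$ such that the following holds. Let $S$ be an arbitrary proper sampling with average minibatch size $b=\mathrm{E}|S|$, let $v$ satisfy $\mathbf{P}-pp^\top\preceq \mathrm{Diag}(p_1v_1,\dots,p_nv_n)$, and let $\alpha$ be the associated quantity defined in the context. Suppose $b\le\alpha n^{2/3}$, and run SAGA with arbitrary sampling from $x^0$ for $T$ iterations with step size $\eta=\dfrac{b}{\mu_3\alpha\bar L n^{2/3}}$ and parameter $d=b/\alpha$. Then the output $x_a$ satisfies $$\mathrm{E}\|\nabla f(x_a)\|^2\le\frac{\alpha\bar L n^{2/3}[f(x^0)-f(x^* )]}{bT\nu_3}.$$ Thus, measured in stochastic gradient evaluations, to obtain an $\epsilon$-accurate solution one needs $$n+\frac{\bar L n^{2/3}(f(x^0)-f(x^* ))}{\epsilon\nu_3}(1+\alpha)$$ evaluations.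
   Context: Problem: $f(x)=\frac1n\sum_{i=1}^n f_i(x)$ with $f_i:\mathbb{R}^N\to\mathbb{R}$ differentiable, $L_i$-smooth ($\|\nabla f_i(x)-\nabla f_i(y)\|\le L_i\|x-y\|$ for all $x,y$), not necessarily convex; $f$ has a minimizer $x^*$; $\bar L=\frac1n\sum_{i=1}^n L_i>0$. A random point $x_a$ is $\epsilon$-accurate if $\mathrm{E}\|\nabla f(x_a)\|^2\le\epsilon$. Sampling: a sampling $S$ is a random subset of $[n]=\{1,\dots,n\}$; $\mathbf{P}_{ij}=\mathrm{Prob}(\{i,j\}\subseteq S)$ is its probability matrix, $p_i=\mathrm{Prob}(i\in S)$, $p=(p_1,\dots,p_n)^\top$; $S$ is proper if $p_i>0$ for all $i$; $b=\mathrm{E}|S|=\sum_i p_i$. For $v\in\mathbb{R}^n$ with $\mathbf{P}-pp^\top\preceq\mathrm{Diag}(p_1v_1,\dots,p_nv_n)$ set $K=\frac{b}{n^2}\sum_{i=1}^n\frac{v_iL_i^2}{p_i}$ and $\alpha=K/\bar L^2$. SAGA with arbitrary sampling $(x^0,d,T,\eta,S)$: set $\alpha_i^0=x^0$ for $i\in[n]$, $g^0=\frac1n\sum_{i=1}^n\nabla f_i(\alpha_i^0)$. For $t=0,\dots,T-1$: draw a fresh random set $S_t\sim S$ and, independently, a random set $J_t\subset[n]$ with $\mathrm{Prob}(j\in J_t)=d/n$ for every $j$; set $v^t=\sum_{i\in S_t}\frac{1}{np_i}\left(\nabla f_i(x^t)-\nabla f_i(\alpha_i^t)\right)+g^t$,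 $x^{t+1}=x^t-\eta v^t$; $\alpha_j^{t+1}=x^t$ for $j\in J_t$ and $\alpha_j^{t+1}=\alpha_j^t$ for $j\notin J_t$; $g^{t+1}=g^t-\frac1n\sum_{j\in J_t}\left(\nabla f_j(\alpha_j^t)-\nabla f_j(\alpha_j^{t+1})\right)$. Output: $x_a$ chosen uniformly at random from $\{x^t:0\le t\le T-1\}$. (The vectors $\alpha_i^t$ are unrelated to the scalar $\alpha$.) The initial full gradient counts as $n$ stochastic gradient evaluations and each iteration as $d+b$. *)

(* Defs.v *)
From HB Require Import structures.
From mathcomp Require Import all_boot all_order all_algebra.
From mathcomp Require Import all_classical all_reals all_analysis.

Set Implicit Arguments.
Unset Strict Implicit.
Unset Printing Implicit Defensive.

Import Order.TTheory GRing.Theory Num.Theory.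
Import numFieldNormedType.Exports.

Local Open Scope classical_set_scope.
Local Open Scope ring_scope.

Section Calculus.
Context {R : realType} {N : nat}.
Implicit Types (f : 'rV[R]_N -> R) (x y : 'rV[R]_N).

(* The library norm `|x| on row vectors is the sup norm, hence this one. *)
Definition l2norm x : R := Num.sqrt (\sum_j x ord0 j ^+ 2).

Definition grad f x : 'rV[R]_N := \row_j 'd f x (delta_mx ord0 j).

Definition smooth (L : R) f : Prop :=
  forall x y, l2norm (grad f x - grad f y) <= L * l2norm (x - y).

End Calculus.

Section Average.
Context {R : realType} {n : nat}.

Definition avg (a : 'I_n -> R) : R := n%:R^-1 * \sum_i a i.

Definition favg (N : nat) (fs : 'I_n -> 'rV[R]_N -> R) : 'rV[R]_N -> R :=
  fun x => avg (fun i => fs i x).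

End Average.

Section Loewner.
Context {R : realType} {n : nat}.

Definition psd (M : 'M[R]_n) : Prop :=
  M^T = M /\ forall h : 'cV[R]_n, 0 <= (h^T *m M *m h) ord0 ord0.

Definition loewner_le (A B : 'M[R]_n) : Prop := psd (B - A).

End Loewner.

(* A sampling enters only through its law, a probability mass function on
   the subsets of 'I_n. *)
Record sampling (R : realType) (n : nat) := Sampling {
  pmf :> {set 'I_n} -> R;
  pmf_ge0 : forall A, 0 <= pmf A;
  pmf_sum1 : \sum_A pmf A = 1 }.

Section SamplingQuantities.
Context {R : realType} {n : nat}.
Variable S : sampling R n.

Definition prob_mx : 'M[R]_n :=
  \matrix_(i, j) \sum_(A : {set 'I_n} | [set i; j]%SET \subset A) S A.

Definition pvec : 'cV[R]_n := \col_i \sum_(A : {set 'I_n} | i \in A) S A.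

Definition proper_sampling : Prop := forall i, 0 < pvec i ord0.

Definition avg_size : R := \sum_(A : {set 'I_n}) S A * #|A|%:R.

Definition eso (v : 'I_n -> R) : Prop :=
  loewner_le (prob_mx - pvec *m pvec^T)
             (diag_mx (\row_i (pvec i ord0 * v i))).

Definition Kconst (v L : 'I_n -> R) : R :=
  avg_size / n%:R ^+ 2 * \sum_i v i * L i ^+ 2 / pvec i ord0.

Definition alphaconst (v L : 'I_n -> R) : R := Kconst v L / avg L ^+ 2.

End SamplingQuantities.

Section Saga.
Context {R : realType} {N n : nat}.
Variables (fs : 'I_n -> 'rV[R]_N -> R) (S : sampling R n).

(* x^t, the table (alpha_i^t)_i, and g^t *)
Record saga_state := SagaState {
  iterate : 'rV[R]_N;
  table : 'I_n -> 'rV[R]_N;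
  gavg : 'rV[R]_N }.

Definition saga_init (x0 : 'rV[R]_N) : saga_state :=
  SagaState x0 (fun=> x0) (n%:R^-1 *: \sum_i grad (fs i) x0).

Definition saga_step (eta : R) (St Jt : {set 'I_n}) (s : saga_state) :
    saga_state :=
  let vt := \sum_(i in St) (n%:R * pvec S i ord0)^-1 *:
              (grad (fs i) (iterate s) - grad (fs i) (table s i)) + gavg s in
  let table' := fun j => if j \in Jt then iterate s else table s j in
  SagaState
    (iterate s - eta *: vt)
    table'
    (gavg s - n%:R^-1 *:
       \sum_(j in Jt) (grad (fs j) (table s j) - grad (fs j) (table' j))).

Fixpoint saga (x0 : 'rV[R]_N) (eta : R) (Ss Js : nat -> {set 'I_n}) (t : nat) :
    saga_state :=
  if t is t'.+1 then saga_step eta (Ss t') (Js t') (saga x0 eta Ss Js t')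
  else saga_init x0.

End Saga.

(* The randomness of T iterations: the sets S_t and J_t for t < T, and the
   uniform index selecting the output, all mutually independent.  Only the
   marginals of J_t are prescribed, so its law may vary with t. *)
Record saga_draws (R : realType) (n : nat) (S : sampling R n) (d : R) (T : nat)
    (disp : measure_display) (Omega : measurableType disp)
    (P : probability Omega R) := SagaDraws {
  drawS : nat -> Omega -> {set 'I_n};
  drawJ : nat -> Omega -> {set 'I_n};
  drawI : Omega -> 'I_T;
  measurable_drawS : forall t A, (t < T)%N ->
    measurable [set w | drawS t w = A];
  measurable_drawJ : forall t A, (t < T)%N ->
    measurable [set w | drawJ t w = A];
  measurable_drawI : forall t, measurable [set w | drawI w = t];
  law_drawS : forall t A, (t < T)%N -> P [set w | drawS t w = A] = (S A)%:E;
  law_drawJ : forall t j, (t < T)%N ->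
    P [set w | j \in drawJ t w] = (d / n%:R)%:E;
  law_drawI : forall t, P [set w | drawI w = t] = (T%:R^-1)%:E;
  indep_draws : forall (A B : 'I_T -> {set {set 'I_n}}) (C : {set 'I_T}),
    P [set w | [/\ forall t : 'I_T, drawS t w \in A t,
                   forall t : 'I_T, drawJ t w \in B t & drawI w \in C]] =
    ((\prod_(t < T) P [set w | drawS t w \in A t]) *
     (\prod_(t < T) P [set w | drawJ t w \in B t]) *
     P [set w | drawI w \in C])%E }.

Definition saga_output (R : realType) (N n : nat)
    (fs : 'I_n -> 'rV[R]_N -> R) (S : sampling R n) (x0 : 'rV[R]_N) (d eta : R)
    (T : nat) (disp : measure_display) (Omega : measurableType disp)
    (P : probability Omega R) (D : saga_draws S d T P) (w : Omega) : 'rV[R]_N :=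
  iterate (saga fs S x0 eta (drawS D ^~ w) (drawJ D ^~ w) (drawI D w)).

Definition mean_sq_grad (R : realType) (N : nat) (f : 'rV[R]_N -> R)
    (disp : measure_display) (Omega : measurableType disp)
    (P : probability Omega R) (xa : Omega -> 'rV[R]_N) : \bar R :=
  'E_P[fun w => l2norm (grad f (xa w)) ^+ 2].

Definition eps_accurate (R : realType) (N : nat) (f : 'rV[R]_N -> R) (eps : R)
    (disp : measure_display) (Omega : measurableType disp)
    (P : probability Omega R) (xa : Omega -> 'rV[R]_N) : Prop :=
  (mean_sq_grad f P xa <= eps%:E)%E.

(* Stochastic gradient evaluations spent by T iterations. *)
Definition saga_evals (R : realType) (n : nat) (d b : R) (T : nat) : R :=
  n%:R + T%:R * (d + b).

(* Main.v *)
Require Import Defs.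
From mathcomp Require Import all_boot all_order all_algebra.
From mathcomp Require Import all_classical all_reals all_analysis.
From mathcomp Require Import measurable_realfun ring lra.
Import Order.TTheory GRing.Theory Num.Theory.
Import numFieldNormedType.Exports.
Local Open Scope classical_set_scope.
Local Open Scope ring_scope.

Set Implicit Arguments.
Unset Strict Implicit.
Unset Printing Implicit Defensive.

(** The proof is a Lyapunov argument.  Write [p i] for the inclusion
    probabilities, [n = a ^+ 3], [r = b / alpha] (so [d = r <= a ^+ 2]) and [l]
    for the average smoothness constant.  For a SAGA state with iterate [x] and
    table entries [y_i], put
      [spread = sum_i q_i |x - y_i| ^ 2],  [q_i = v_i L_i ^ 2 / (n ^ 2 p_i)].
    The weights are not uniform: they are those that bound the variance of the
    estimator.  Tested on a vector, the matrix inequality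
    [P - p p^T <= Diag (p v)] is a variance bound ([eso_variance]), hence the
    estimator has mean [grad f x] and second moment at most
    [|grad f x| ^ 2 + spread] ([estimator_second_moment]).  The total weight is
    [sum_i q_i = alpha l ^ 2 / b = l ^ 2 / r].

    Each table entry is refreshed with probability [d / n], so the spread
    contracts by [1 - d / n] while a step moves it by [eta ^ 2 |estimator| ^ 2]
    and a cross term.  Adding [c * spread] to [f] for a suitable constant [c]
    absorbs what the variance costs in the descent inequality, so that
    [f + c * spread] decreases in expectation by [eta / 2 * |grad f x| ^ 2]
    per iteration ([lyapunov_drift]).  The constants are [mu3 = 4],
    [nu3 = 1 / 8], [c = r / (8 a l)] ([step_size_conditions]).  The exponent
    [2 / 3] comes from the cross term: for a step of order [r / (l n ^ s)],
    letting the contraction absorb the variance makes [c] of order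
    [l eta ^ 2 / (r / n)], and splitting the cross term by Young's inequality
    then leaves a gradient term of order [n ^ (2 - 3 s)] times the gain, so
    [s = 2 / 3] is the longest step allowed.  Summing over the iterations, with
    initial spread [0] and [f] bounded below by its minimum, gives the rate
    ([mean_grad_sum], [saga_rate]).

    The randomness is finite: the output is a function of the history of the
    sets drawn and of the output index, whose joint law is a product.  So the
    expectation over the probability space is a finite sum against product
    weights ([mean_sq_grad_output]), in which conditioning on the past becomes
    the resampling of one coordinate ([resample]).

    The complexity statement is the rate read backwards:
    [d + b = (b / alpha) * (1 + alpha)] is the cost of an iteration. *)

Lemma eq_ler (R : numDomainType) (x y : R) : x = y -> x <= y.
Proof. by move=> ->. Qed.

(** * The Euclidean inner product *)

Section Euclidean.
Context {R : realType} {N : nat}.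
Implicit Types (u v w : 'rV[R]_N) (a : R).

Definition dot u v : R := \sum_j u ord0 j * v ord0 j.

Lemma dotC u v : dot u v = dot v u.
Proof. by apply: eq_bigr => j _; rewrite mulrC. Qed.

Lemma dotDl u v w : dot (u + v) w = dot u w + dot v w.
Proof.
by rewrite /dot -big_split; apply: eq_bigr => j _; rewrite mxE mulrDl.
Qed.

Lemma dotZl a u v : dot (a *: u) v = a * dot u v.
Proof. by rewrite /dot mulr_sumr; apply: eq_bigr => j _; rewrite mxE mulrA. Qed.

Lemma dotNl u v : dot (- u) v = - dot u v.
Proof. by rewrite -scaleN1r dotZl mulN1r. Qed.

Lemma dotDr u v w : dot u (v + w) = dot u v + dot u w.
Proof. by rewrite dotC dotDl !(dotC u). Qed.

Lemma dotZr a u v : dot u (a *: v) = a * dot u v.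
Proof. by rewrite dotC dotZl dotC. Qed.

Lemma dotNr u v : dot u (- v) = - dot u v.
Proof. by rewrite dotC dotNl dotC. Qed.

Definition dotE := (dotDl, dotDr, dotZl, dotZr, dotNl, dotNr).

Lemma dot0r u : dot u 0 = 0.
Proof. by rewrite -(scale0r 0) dotZr mul0r. Qed.

Lemma dot_sumr (I : Type) (r : seq I) (P : pred I) u (F : I -> 'rV[R]_N) :
  dot u (\sum_(i <- r | P i) F i) = \sum_(i <- r | P i) dot u (F i).
Proof.
by elim/big_rec2: _ => [|i y1 y2 _ <-]; rewrite ?dot0r ?dotDr.
Qed.

Lemma dot_suml (I : Type) (r : seq I) (P : pred I) u (F : I -> 'rV[R]_N) :
  dot (\sum_(i <- r | P i) F i) u = \sum_(i <- r | P i) dot (F i) u.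
Proof. by rewrite dotC dot_sumr; apply: eq_bigr => i _; rewrite dotC. Qed.

Lemma dot_ge0 u : 0 <= dot u u.
Proof. by apply: sumr_ge0 => j _; rewrite -expr2 sqr_ge0. Qed.

Lemma l2norm_ge0 u : 0 <= l2norm u.
Proof. exact: sqrtr_ge0. Qed.

Lemma l2norm_sqr u : l2norm u ^+ 2 = dot u u.
Proof.
have E : \sum_j u ord0 j ^+ 2 = dot u u by apply: eq_bigr => j _; rewrite expr2.
by rewrite /l2norm E sqr_sqrtr ?dot_ge0.
Qed.

(** Expanding [|k w - u|^2 >= 0]. *)
Lemma dot_young (k : R) u w :
  0 < k -> - 2 * dot u w <= k * dot w w + k^-1 * dot u u.
Proof.
move=> k0; rewrite -(ler_pM2l k0).
have := dot_ge0 (k *: w + u).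
have kV : k * (k^-1 * dot u u) = dot u u by rewrite mulrA divff ?mul1r ?gt_eqF.
by rewrite mulrDr kV !dotE (dotC w u); nra.
Qed.

(** Expanding [| |v|^2 u - <u, v> v |^2 >= 0]. *)
Lemma cauchy_schwarz u v : dot u v <= l2norm u * l2norm v.
Proof.
have [vv0|vv] := leP (dot v v) 0.
  have v0 : v = 0.
    have /eqP := le_anti (introT andP (conj vv0 (dot_ge0 v))).
    rewrite psumr_eq0 => [/allP z|j _]; last by rewrite -expr2 sqr_ge0.
    apply/rowP => j; have := z j (mem_index_enum j).
    by rewrite mulf_eq0 orbb mxE => /eqP.
  by rewrite v0 dot0r mulr_ge0 ?l2norm_ge0.
have sq : dot u v ^+ 2 <= dot u u * dot v v.
  rewrite -(ler_pM2l vv).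
  have := dot_ge0 (dot v v *: u - dot u v *: v).
  by rewrite !dotE (dotC v u); nra.
have [|uv] := ltP (dot u v) 0.
  by move/ltW/le_trans; apply; rewrite mulr_ge0 ?l2norm_ge0.
by rewrite -(@ler_pXn2r _ 2) ?nnegrE ?mulr_ge0 ?l2norm_ge0 // exprMn !l2norm_sqr.
Qed.

End Euclidean.

(** * Smooth functions and the descent inequality *)

Section Smoothness.
Context {R : realType} {N : nat}.
Implicit Types (f : 'rV[R]_N -> R) (x y h : 'rV[R]_N).

Lemma diff_grad f x h : 'd f x h = dot (grad f x) h.
Proof.
rewrite {1}(row_sum_delta h) linear_sum /dot; apply: eq_bigr => j _.
by rewrite linearZ /= mxE mulrC.
Qed.

Lemma smooth_sqr (L : R) f x y : smooth L f ->
  dot (grad f x - grad f y) (grad f x - grad f y)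
    <= L ^+ 2 * dot (x - y) (x - y).
Proof.
move=> /(_ x y) sm; rewrite -!l2norm_sqr -exprMn.
rewrite ler_pXn2r // nnegrE ?l2norm_ge0 //.
exact: le_trans (l2norm_ge0 _) sm.
Qed.

Lemma is_derive_line f x h (t : R) :
  differentiable f (x + t *: h) ->
  is_derive t (1 : R) (fun s : R => f (x + s *: h))
    (dot (grad f (x + t *: h)) h).
Proof.
move=> df; rewrite -diff_grad -deriveE //.
have dv : derivable f (x + t *: h) h by exact: diff_derivable.
(* The two difference quotients are the same function. *)
have E : (fun k : R => k^-1 *: (((fun s : R => f (x + s *: h)) \o shift t)
                                  (k *: (1 : R)) - f (x + t *: h)))
  = (fun k : R => k^-1 *: ((f \o shift (x + t *: h)) (k *: h)
                            - f (x + t *: h))).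
  apply/funext => k /=; congr (_ *: (f _ - _)).
  by rewrite [k *: 1]mulr1 scalerDl addrCA.
split; first by rewrite /derivable E.
by rewrite /derive E.
Qed.

(** The function [u t - B t - k t ^+ 2] is nonincreasing on the positive reals. *)
Lemma le_quadratic (u du : R -> R) (B k : R) :
  (forall t : R, is_derive t (1 : R) u (du t)) ->
  (forall t, 0 <= t -> du t - B <= 2 * k * t) ->
  u 1 <= u 0 + B + k.
Proof.
move=> Du le_du.
pose phi (t : R) := u t - B * t - k * t ^+ 2.
pose dphi (t : R) := du t - B - 2 * k * t.
have D t : is_derive t (1 : R) phi (dphi t).
  have Dut := Du t; apply: is_derive_eq; rewrite /dphi.
  (* Scaling in the module [R] over itself is multiplication. *)
  change (du t - B * 1 - k * (t * 1 + t * 1) = du t - B - 2 * k * t).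
  by ring.
have C : {within `[0, 1 : R], continuous phi}.
  apply: continuous_subspaceT => t.
  by apply/differentiable_continuous/derivable1_diffP; have [] := D t.
have [t t01] := @MVT R phi dphi 0 1 ltr01 (fun t _ => D t) C.
have t0 : 0 <= t by move: t01; rewrite in_itv /= => /andP[/ltW].
by have := le_du t t0; rewrite /phi /dphi; lra.
Qed.

Lemma l2normZ (t : R) x : 0 <= t -> l2norm (t *: x) = t * l2norm x.
Proof.
move=> t0; apply/eqP; rewrite -(@eqrXn2 _ 2) ?mulr_ge0 ?l2norm_ge0 //.
by rewrite exprMn !l2norm_sqr dotZl dotZr mulrA expr2.
Qed.

(** Along the segment, the derivative [<grad f (x + t h), h>] exceeds its value
    at [0] by at most [|grad f (x + t h) - grad f x| |h| <= t L |h|^2]. *)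
Lemma descent f (L : R) x h : (forall z, differentiable f z) -> smooth L f ->
  f (x + h) <= f x + dot (grad f x) h + L / 2 * dot h h.
Proof.
move=> df sm.
have := @le_quadratic (fun s => f (x + s *: h))
  (fun t => dot (grad f (x + t *: h)) h) (dot (grad f x) h) (L / 2 * dot h h).
rewrite scale1r scale0r addr0; apply=> [t|t t0]; first exact: is_derive_line.
rewrite -dotNl -dotDl; apply: le_trans (cauchy_schwarz _ _) _.
have := ler_wpM2r (l2norm_ge0 h) (sm (x + t *: h) x).
move=> /le_trans; apply; rewrite addrAC subrr add0r l2normZ // -(l2norm_sqr h).
by apply: eq_ler; field.
Qed.

End Smoothness.

(** * First and second moments of a sampling *)

Section SamplingMoments.
Context {R : realType} {n : nat}.
Variable S : sampling R n.
Notation p i := (pvec S i ord0).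

Lemma pvecE i : p i = \sum_(A : {set 'I_n} | i \in A) S A.
Proof. by rewrite mxE. Qed.

Lemma pvec_le1 i : p i <= 1.
Proof.
rewrite pvecE -(pmf_sum1 S) [leRHS](bigID (fun A : {set 'I_n} => i \in A)) /=.
by rewrite lerDl sumr_ge0 // => A _; apply: Defs.pmf_ge0.
Qed.

Lemma sampling_mean (h : 'I_n -> R) :
  \sum_A S A * (\sum_(i in A) h i) = \sum_i p i * h i.
Proof.
under eq_bigr => A _ do rewrite mulr_sumr.
rewrite (exchange_big_dep xpredT) //=; apply: eq_bigr => i _.
by rewrite pvecE mulr_suml.
Qed.

Lemma avg_sizeE : avg_size S = \sum_i p i.
Proof.
rewrite -[RHS](eq_bigr _ (fun i _ => mulr1 _)) -sampling_mean.
by apply: eq_bigr => A _; rewrite sumr_const.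
Qed.

Lemma quad_formE (M : 'M[R]_n) (h : 'cV[R]_n) :
  (h^T *m M *m h) ord0 ord0 = \sum_i \sum_j h i ord0 * h j ord0 * M i j.
Proof.
rewrite mxE exchange_big /=; apply: eq_bigr => j _.
rewrite mxE mulr_suml; apply: eq_bigr => i _.
by rewrite mxE mulrAC.
Qed.

(** For the vector [h], the two sides of the matrix inequality are the
    variance of [\sum_(i in A) h i] and [\sum_i p i * v i * h i ^+ 2]. *)
Lemma eso_variance (v h : 'I_n -> R) : eso S v ->
  \sum_A S A * (\sum_(i in A) h i) ^+ 2
    <= (\sum_i p i * h i) ^+ 2 + \sum_i p i * v i * h i ^+ 2.
Proof.
case=> _ /(_ (\col_i h i)); rewrite quad_formE.
have sq (g : 'I_n -> R) (Q : pred 'I_n) :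
    (\sum_(i | Q i) g i) ^+ 2 = \sum_(i | Q i) \sum_(j | Q j) g i * g j.
  by rewrite expr2 mulr_suml; apply: eq_bigr => i _; rewrite mulr_sumr.
have -> : \sum_A S A * (\sum_(i in A) h i) ^+ 2 =
    \sum_i \sum_j h i * h j * prob_mx S i j.
  under eq_bigr => A _ do rewrite sq mulr_sumr.
  rewrite (exchange_big_dep xpredT) //=; apply: eq_bigr => i _.
  under eq_bigr => A _ do rewrite mulr_sumr.
  rewrite (exchange_big_dep xpredT) //=; apply: eq_bigr => j _.
  rewrite mxE mulr_sumr; apply: eq_big => [A|A _]; last by rewrite mulrC.
  by rewrite finset.subUset !finset.sub1set.
move=> quad_ge0; rewrite sq -subr_ge0; apply: le_trans quad_ge0 _; apply: eq_ler.
rewrite -big_split -sumrB; apply: eq_bigr => i _ /=.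
(* The diagonal term is spread over a whole row of the double sum. *)
have -> : p i * v i * h i ^+ 2 =
    \sum_j h i * h j * (if i == j then p i * v i else 0).
  rewrite (bigD1 i) //= eqxx big1 => [|j /negbTE ji]; first by rewrite addr0; ring.
  by rewrite eq_sym ji mulr0.
rewrite -big_split -sumrB; apply: eq_bigr => j _ /=.
rewrite !mxE big_ord1 !mxE mulrb; case: eqP => _; ring.
Qed.

(** A variance is nonnegative; here that of the indicator of [i \in A], which
    is [p i * (1 - p i)]. *)
Lemma eso_ge0 (v : 'I_n -> R) i : proper_sampling S -> eso S v -> 0 <= v i.
Proof.
move=> /(_ i) pi0 /(@eso_variance v (fun j => (j == i)%:R)).
have selA (Q : pred 'I_n) (a : 'I_n -> R) :
    \sum_(j | Q j) a j * (j == i)%:R = if Q i then a i else 0.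
  case: ifP => Qi.
    rewrite (bigD1 i) //= eqxx mulr1 big1 ?addr0 // => j /andP[_ /negbTE ->].
    by rewrite mulr0.
  by rewrite big1 // => j; case: eqP => [->|]; rewrite ?Qi ?mulr0.
have -> : \sum_A S A * (\sum_(j in A) (j == i)%:R) ^+ 2 = p i.
  rewrite pvecE [RHS]big_mkcond; apply: eq_bigr => A _.
  under eq_bigr => j _ do rewrite -[_%:R]mul1r.
  rewrite (selA (fun j => j \in A)); case: ifP => _.
    by rewrite expr1n mulr1.
  by rewrite expr0n mulr0.
under [X in _ + X]eq_bigr => j _ do rewrite expr2 -natrM mulnb andbb.
rewrite !(selA xpredT) /= => var_le.
have : 0 <= p i * v i by have := pvec_le1 i; nra.
by rewrite pmulr_rge0.
Qed.

(** The bound on the variance, applied to each coordinate; the deterministic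
    shift [g] only moves the mean. *)
Lemma eso_second_moment (N : nat) (v : 'I_n -> R) (xi : 'I_n -> 'rV[R]_N) g
    (m := \sum_i p i *: xi i + g) :
  eso S v ->
  \sum_A S A * dot (\sum_(i in A) xi i + g) (\sum_(i in A) xi i + g)
    <= dot m m + \sum_i p i * v i * dot (xi i) (xi i).
Proof.
move=> Sv.
have -> : \sum_i p i * v i * dot (xi i) (xi i) =
    \sum_j \sum_i p i * v i * xi i ord0 j ^+ 2.
  rewrite exchange_big; apply: eq_bigr => i _ /=.
  by rewrite /dot mulr_sumr; apply: eq_bigr => j _; rewrite expr2.
rewrite -big_split /=.
under eq_bigr => A _ do rewrite /dot mulr_sumr.
rewrite exchange_big /=; apply: ler_sum => j _.
have := eso_variance (fun i => xi i ord0 j) Sv.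
rewrite -sampling_mean.
set X := fun A : {set 'I_n} => \sum_(i in A) xi i ord0 j.
have -> : m ord0 j = \sum_A S A * X A + g ord0 j.
  rewrite /m mxE summxE sampling_mean; congr (_ + _).
  by apply: eq_bigr => i _; rewrite mxE.
have -> : \sum_A S A * ((\sum_(i in A) xi i + g) ord0 j
                         * (\sum_(i in A) xi i + g) ord0 j) =
    \sum_A S A * X A ^+ 2 + 2 * g ord0 j * (\sum_A S A * X A) + g ord0 j ^+ 2.
  have -> : g ord0 j ^+ 2 = \sum_A S A * g ord0 j ^+ 2.
    by rewrite -mulr_suml pmf_sum1 mul1r.
  rewrite mulr_sumr -!big_split.
  apply: eq_bigr => A _ /=; rewrite mxE summxE -/(X A); ring.
set Y := \sum_A S A * X A => var_le.
have {}var_le : \sum_A S A * X A ^+ 2 <=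
    Y ^+ 2 + \sum_i p i * v i * xi i ord0 j ^+ 2 by [].
move: (\sum_A S A * X A ^+ 2) (\sum_i _) var_le => V W; lra.
Qed.

End SamplingMoments.

(** * Averages of smooth functions *)

Section FiniteSum.
Context {R : realType} {N n : nat}.
Variables (fs : 'I_n -> 'rV[R]_N -> R) (L : 'I_n -> R).
Hypothesis fs_diff : forall i x, differentiable (fs i) x.
Hypothesis fs_smooth : forall i, smooth (L i) (fs i).

Lemma grad_favg x : grad (favg fs) x = n%:R^-1 *: \sum_i grad (fs i) x.
Proof.
have E : favg fs = n%:R^-1 *: (\sum_i fs i).
  by apply/funext => y; rewrite /favg /avg !fctE fct_sumE.
apply/rowP => j; rewrite !mxE summxE E.
have D i : derivable (fs i) x (delta_mx ord0 j) by exact: diff_derivable.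
rewrite -deriveE; last by apply: differentiableZ; apply: differentiable_sum.
rewrite deriveZ ?derive_sum //; last exact: derivable_sum.
by congr (_ * _); apply: eq_bigr => i _; rewrite mxE deriveE.
Qed.

(** Averaging the descent inequalities of the summands replaces the smoothness
    constants by their mean. *)
Lemma descent_favg x h :
  favg fs (x + h) <= favg fs x + dot (grad (favg fs) x) h + avg L / 2 * dot h h.
Proof.
rewrite grad_favg /favg /avg dotZl dot_suml -!mulrA -!mulrDr.
rewrite ler_wpM2l ?invr_ge0 // mulr_suml -!big_split /=.
by apply: ler_sum => i _; rewrite mulrA; apply: descent.
Qed.

End FiniteSum.

(** * The expected effect of one iteration *)

Section Drift.
Context {R : realType} {N n : nat}.
Variables (fs : 'I_n -> 'rV[R]_N -> R) (S : sampling R n) (v L : 'I_n -> R).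
Hypothesis fs_diff : forall i x, differentiable (fs i) x.
Hypothesis fs_smooth : forall i, smooth (L i) (fs i).
Hypothesis Lbar_gt0 : 0 < avg L.
Hypothesis S_proper : proper_sampling S.
Hypothesis S_eso : eso S v.
Implicit Types s : saga_state (R := R) (N := N) (n := n).

Notation p i := (pvec S i ord0).
Notation G s := (grad (favg fs) (iterate s)).

(** The weight that the variance bound puts on [|x - alpha_i|^2]. *)
Definition weight i : R := v i * L i ^+ 2 / (n%:R ^+ 2 * p i).

Definition spread s : R :=
  \sum_i weight i * dot (iterate s - table s i) (iterate s - table s i).

Definition lyapunov (c : R) s : R := favg fs (iterate s) + c * spread s.

(** The running average [gavg] is updated incrementally; that it stays equal to
    the average gradient over the table is what makes the estimator unbiased. *)
Definition coherent s : Prop :=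
  gavg s = n%:R^-1 *: \sum_i grad (fs i) (table s i).

Definition estimator s (A : {set 'I_n}) : 'rV[R]_N :=
  \sum_(i in A) (n%:R * p i)^-1 *:
     (grad (fs i) (iterate s) - grad (fs i) (table s i)) + gavg s.

Lemma n_gt0 : 0 < n%:R :> R.
Proof.
move: Lbar_gt0; rewrite /avg ltr0n; case: n L => // L'.
by rewrite big_ord0 mulr0 ltxx.
Qed.

Lemma weight_ge0 i : 0 <= weight i.
Proof.
have vi0 := eso_ge0 i S_proper S_eso.
have pi0 := ltW (S_proper i).
by rewrite divr_ge0 // mulr_ge0 // sqr_ge0.
Qed.

Lemma spread_ge0 s : 0 <= spread s.
Proof. by apply: sumr_ge0 => i _; rewrite mulr_ge0 ?weight_ge0 ?dot_ge0. Qed.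

Lemma coherent_step eta A B s :
  coherent s -> coherent (saga_step fs S eta A B s).
Proof.
rewrite /coherent /= => ->; rewrite -scalerBr; congr (_ *: _).
rewrite [X in _ - X]big_mkcond -sumrB; apply: eq_bigr => i _.
by case: (i \in B); [exact: subKr | exact: subr0].
Qed.

Lemma coherent_mean s : coherent s ->
  \sum_i p i *: ((n%:R * p i)^-1 *:
    (grad (fs i) (iterate s) - grad (fs i) (table s i))) + gavg s = G s.
Proof.
move=> ->; rewrite (grad_favg fs_diff).
rewrite [RHS]scaler_sumr [X in _ + X]scaler_sumr -big_split.
apply: eq_bigr => i _ /=.
have -> : p i *: ((n%:R * p i)^-1 *: (grad (fs i) (iterate s)
    - grad (fs i) (table s i))) =
    n%:R^-1 *: (grad (fs i) (iterate s) - grad (fs i) (table s i)).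
  by rewrite scalerA invfM mulrCA divff ?mulr1 // gt_eqF.
by rewrite -scalerDr subrK.
Qed.

Lemma estimator_mean s w : coherent s ->
  \sum_A S A * dot (estimator s A) w = dot (G s) w.
Proof.
move=> /coherent_mean <-.
under eq_bigr => A _ do rewrite dotDl dot_suml mulrDr.
rewrite big_split /= sampling_mean -mulr_suml pmf_sum1 mul1r dotDl dot_suml.
by congr (_ + _); apply: eq_bigr => i _; rewrite -dotZl.
Qed.

(** [weight] is the factor [p i * v i / (n p i) ^+ 2] of the variance bound,
    multiplied by the square [L i ^+ 2] of the Lipschitz constant of the
    gradients. *)
Lemma estimator_second_moment s : coherent s ->
  \sum_A S A * dot (estimator s A) (estimator s A)
    <= dot (G s) (G s) + spread s.
Proof.
move=> cs; apply: le_trans (eso_second_moment _ _ S_eso) _.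
rewrite coherent_mean // lerD2l; apply: ler_sum => i _.
have pi0 := S_proper i; have nn0 := n_gt0.
set u := grad _ _ - grad _ _; set y := iterate s - table s i.
rewrite dotZl dotZr.
have factor z : p i * v i * ((n%:R * p i)^-1 * ((n%:R * p i)^-1 * z))
    = v i / (n%:R ^+ 2 * p i) * z.
  by field; rewrite !gt_eqF.
have weightE z : weight i * z = v i / (n%:R ^+ 2 * p i) * (L i ^+ 2 * z).
  by rewrite /weight; ring.
rewrite factor weightE; apply: ler_wpM2l; last exact: smooth_sqr.
have vi0 := eso_ge0 i S_proper S_eso.
by apply: divr_ge0 => //; rewrite mulr_ge0 ?sqr_ge0 // ltW.
Qed.

Variables (J : {set 'I_n} -> R) (theta : R).
Hypothesis J_sum1 : \sum_B J B = 1.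
Hypothesis J_marginal : forall j, \sum_(B : {set 'I_n} | j \in B) J B = theta.

Lemma refresh_mean i (a c : R) :
  \sum_B J B * (if i \in B then a else c) = theta * a + (1 - theta) * c.
Proof.
have split1 := J_sum1.
rewrite (bigID (fun B : {set 'I_n} => i \in B)) /= J_marginal in split1.
rewrite (bigID (fun B : {set 'I_n} => i \in B)) /=; congr (_ + _).
  by rewrite -(J_marginal i) mulr_suml; apply: eq_bigr => B ->.
rewrite -split1 addrC addrK mulr_suml.
by apply: eq_bigr => B /negbTE ->.
Qed.

(** The mean of the spread over the refreshed set only: an entry becomes the
    old iterate, at distance [eta |w|] of the new one, with probability
    [theta], and is kept otherwise. *)
Lemma spread_refresh eta A s (w := estimator s A) :
  \sum_B J B * spread (saga_step fs S eta A B s) =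
    (\sum_i weight i) * eta ^+ 2 * dot w w
    + (1 - theta) * (spread s
        - 2 * eta * dot w (\sum_i weight i *: (iterate s - table s i))).
Proof.
rewrite /spread; under eq_bigr => B _ do rewrite mulr_sumr.
rewrite exchange_big /= dot_sumr !mulr_suml mulr_sumr -sumrB mulr_sumr -big_split.
apply: eq_bigr => i _ /=; rewrite -/(estimator s A) -/w.
move: w (iterate s) (table s i) => w x y.
pose a := weight i * dot (eta *: w) (eta *: w).
pose c := weight i * dot (x - y - eta *: w) (x - y - eta *: w).
transitivity (\sum_B J B * (if i \in B then a else c)).
  apply: eq_bigr => B _; congr (_ * _); case: ifP => _.
    by rewrite addrAC subrr add0r /a dotNl dotNr opprK.
  by rewrite addrAC.
rewrite refresh_mean /a /c !dotE (dotC x w) (dotC y w) (dotC y x); ring.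
Qed.

(** In expectation the function value drops by [eta |grad f|^2], up to
    [eta ^+ 2] times the second moment of the estimator, which the spread
    bounds.  The spread contracts by [1 - theta] and its cross term is split
    by Young's inequality with parameter [beta].  The two numerical conditions
    say that the spread terms are absorbed by [c], and the gradient terms by
    half of the gain. *)
Lemma lyapunov_drift (eta c beta : R) s (M := \sum_i weight i) :
  coherent s -> 0 <= eta -> 0 <= c -> 0 < beta -> theta <= 1 ->
  avg L / 2 * eta ^+ 2 + c * M * eta ^+ 2
    + c * (1 - theta) * (1 + eta * beta) <= c ->
  avg L / 2 * eta ^+ 2 + c * M * eta ^+ 2
    + c * (1 - theta) * (eta * M / beta) <= eta / 2 ->
  \sum_A S A * \sum_B J B * lyapunov c (saga_step fs S eta A B s)
    <= lyapunov c s - eta / 2 * dot (G s) (G s).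
Proof.
move=> cs eta0 c0 beta0 theta1 absorb_spread absorb_grad.
pose z := \sum_i weight i *: (iterate s - table s i).
pose w A := estimator s A.
have descend u : favg fs (iterate s - eta *: u) <=
    favg fs (iterate s) - eta * dot u (G s) + avg L / 2 * eta ^+ 2 * dot u u.
  apply: le_trans (descent_favg fs_diff fs_smooth _ _) _; apply: eq_ler.
  rewrite dotNr dotZr dotNl dotNr opprK dotZl dotZr (dotC _ u).
  move: (favg fs _) (dot u (G s)) (dot u u) => F0 uG uu; ring.
have step A : \sum_B J B * lyapunov c (saga_step fs S eta A B s) <=
    favg fs (iterate s) + c * (1 - theta) * spread s
    - eta * dot (w A) (G s) - 2 * c * (1 - theta) * eta * dot (w A) z
    + (avg L / 2 + c * M) * eta ^+ 2 * dot (w A) (w A).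
  have split_lyap B : J B * lyapunov c (saga_step fs S eta A B s) =
      J B * favg fs (iterate s - eta *: w A)
      + c * (J B * spread (saga_step fs S eta A B s)).
    by rewrite /lyapunov mulrDr (mulrCA _ c).
  under eq_bigr => B _ do rewrite split_lyap.
  rewrite big_split /= -mulr_suml J_sum1 mul1r -mulr_sumr spread_refresh.
  rewrite -/(w A) -/M -/z; have := descend (w A).
  move: (favg fs (_ - _)) (dot (w A) (G s)) (dot (w A) z) => F1 wG wz.
  move: (dot (w A) (w A)) (spread s) (favg fs _) => ww V F0 le1; lra.
apply: (@le_trans _ _ (favg fs (iterate s) + c * (1 - theta) * spread s
    - eta * dot (G s) (G s) - 2 * c * (1 - theta) * eta * dot (G s) z
    + (avg L / 2 + c * M) * eta ^+ 2 * \sum_A S A * dot (w A) (w A))).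
  rewrite -(estimator_mean (G s) cs) -(estimator_mean z cs) -/w.
  move: (favg _ _ + _) ((_ + c * M) * _) step => base k step.
  have -> : base = \sum_A S A * base by rewrite -mulr_suml pmf_sum1 mul1r.
  rewrite !mulr_sumr -!sumrB -big_split; apply: ler_sum => A _ /=.
  apply: le_trans (ler_wpM2l (Defs.pmf_ge0 S A) (step A)) _.
  by apply: eq_ler; rewrite -/(w A); ring.
have second := estimator_second_moment cs.
have cross : - 2 * dot (G s) z <= beta * spread s + M / beta * dot (G s) (G s).
  rewrite /z dot_sumr mulr_sumr /spread /M mulr_sumr mulr_suml mulr_suml -big_split /=.
  apply: ler_sum => i _; rewrite dotZr.
  have young := dot_young (G s) (iterate s - table s i) beta0.
  have := ler_wpM2l (weight_ge0 i) young; lra.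
have M0 : 0 <= M by apply: sumr_ge0 => i _; apply: weight_ge0.
have Vpos := spread_ge0 s; have Gpos := dot_ge0 (G s).
have k3 : 0 <= (avg L / 2 + c * M) * eta ^+ 2.
  have half : 0 <= avg L / 2 by rewrite divr_ge0 // ltW.
  by rewrite mulr_ge0 ?sqr_ge0 // addr_ge0 // mulr_ge0.
have k2 : 0 <= c * (1 - theta) * eta by rewrite !mulr_ge0 ?subr_ge0.
have := ler_wpM2l k3 second; have := ler_wpM2l k2 cross.
have := ler_wpM2r Vpos absorb_spread; have := ler_wpM2r Gpos absorb_grad.
rewrite /lyapunov -/(w _); set V := spread s; set g2 := dot (G s) (G s).
set m2 := \sum_A _; set gz := dot (G s) z; lra.
Qed.

End Drift.

(** * Finite product laws *)

Section ProductLaw.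
Context {R : realType} {X : finType} {T : nat}.
Variable w : 'I_T -> X -> R.
Hypothesis w_ge0 : forall t x, 0 <= w t x.
Hypothesis w_sum1 : forall t, \sum_x w t x = 1.

Definition path_weight (a : {ffun 'I_T -> X}) : R := \prod_t w t (a t).

Definition update (a : {ffun 'I_T -> X}) t x : {ffun 'I_T -> X} :=
  [ffun k => if k == t then x else a k].

Lemma path_weight_ge0 a : 0 <= path_weight a.
Proof. by apply: prodr_ge0 => t _. Qed.

Lemma path_weight_sum1 : \sum_a path_weight a = 1.
Proof. by rewrite -bigA_distr_bigA /= big1. Qed.

(** The exchange [(a, x) |-> (update a t x, a t)] is an involution that
    preserves the weight [path_weight a * w t x].  This does the work of
    conditioning on the draws other than the [t]-th. *)
Lemma resample t (F : {ffun 'I_T -> X} -> R) :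
  \sum_a path_weight a * F a
    = \sum_a path_weight a * \sum_x w t x * F (update a t x).
Proof.
transitivity (\sum_a \sum_x path_weight a * w t x * F a).
  by apply: eq_bigr => a _; rewrite -mulr_suml -mulr_sumr w_sum1 mulr1.
rewrite pair_bigA /=.
pose exch (u : {ffun 'I_T -> X} * X) := (update u.1 t u.2, u.1 t).
have exchK : involutive exch.
  case=> a x; rewrite /exch /= ffunE eqxx; congr (_, _).
  by apply/ffunP => k; rewrite !ffunE; case: eqP => [->|].
rewrite (reindex_inj (inv_inj exchK)) /=.
under [RHS]eq_bigr => a _ do rewrite mulr_sumr.
rewrite pair_bigA /=; apply: eq_bigr => -[a x] _ /=; rewrite mulrA; congr (_ * _).
rewrite /path_weight (bigD1 t) //= [in RHS](bigD1 t) //= ffunE eqxx.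
rewrite mulrC [w t x * _]mulrC mulrA; congr (_ * _ * _).
by apply: eq_bigr => k /negbTE kt; rewrite ffunE kt.
Qed.

End ProductLaw.

(** * Trajectories driven by a finite list of draws *)

Section Trajectory.
Context {R : realType} {N n : nat}.
Variables (fs : 'I_n -> 'rV[R]_N -> R) (S : sampling R n).
Variables (x0 : 'rV[R]_N) (eta : R).

Lemma eq_saga (Ss Ss' Js Js' : nat -> {set 'I_n}) t :
  (forall k, (k < t)%N -> Ss k = Ss' k) ->
  (forall k, (k < t)%N -> Js k = Js' k) ->
  saga fs S x0 eta Ss Js t = saga fs S x0 eta Ss' Js' t.
Proof.
elim: t => [//|t IH] eqS eqJ /=; rewrite (eqS t (ltnSn t)) (eqJ t (ltnSn t)).
by rewrite IH => [//|k kt|k kt]; [apply: eqS | apply: eqJ]; apply: ltnW.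
Qed.

Context {T : nat}.
Implicit Types (a : {ffun 'I_T -> {set 'I_n} * {set 'I_n}}).

(** [saga] reads an infinite sequence of draws; the empty sets beyond [T] are
    never used by the first [T] iterations. *)
Definition draw_at a (k : nat) : {set 'I_n} * {set 'I_n} :=
  if insub k is Some i then a i else (finset.set0, finset.set0).

Definition run a (t : nat) : saga_state (R := R) (N := N) (n := n) :=
  saga fs S x0 eta (fun k => (draw_at a k).1) (fun k => (draw_at a k).2) t.

Lemma draw_at_ord a (t : 'I_T) : draw_at a t = a t.
Proof. by rewrite /draw_at valK. Qed.

Lemma run_update a (t : 'I_T) u :
  run (update a t u) t.+1 = saga_step fs S eta u.1 u.2 (run a t).
Proof.
rewrite /run /= !draw_at_ord ffunE eqxx; congr saga_step.
apply: eq_saga => k kt; rewrite /draw_at; case: insubP => // i _ ik;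
  by rewrite ffunE -val_eqE /= ik ltn_eqF.
Qed.

End Trajectory.

(** * Telescoping the drift *)

Section Telescoping.
Context {R : realType} {N n T : nat}.
Variables (fs : 'I_n -> 'rV[R]_N -> R) (S : sampling R n) (v L : 'I_n -> R).
Hypothesis fs_diff : forall i x, differentiable (fs i) x.
Hypothesis fs_smooth : forall i, smooth (L i) (fs i).
Hypothesis Lbar_gt0 : 0 < avg L.
Hypothesis S_proper : proper_sampling S.
Hypothesis S_eso : eso S v.
Variables (J : 'I_T -> {set 'I_n} -> R) (theta : R).
Hypothesis J_ge0 : forall t B, 0 <= J t B.
Hypothesis J_sum1 : forall t, \sum_B J t B = 1.
Hypothesis J_marginal :
  forall t j, \sum_(B : {set 'I_n} | j \in B) J t B = theta.

Definition draw_law (t : 'I_T) (u : {set 'I_n} * {set 'I_n}) : R :=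
  S u.1 * J t u.2.

Lemma draw_law_ge0 t u : 0 <= draw_law t u.
Proof. by rewrite mulr_ge0 ?Defs.pmf_ge0. Qed.

Lemma draw_law_sum t (F : {set 'I_n} -> {set 'I_n} -> R) :
  \sum_u draw_law t u * F u.1 u.2 = \sum_A S A * \sum_B J t B * F A B.
Proof.
under [RHS]eq_bigr => A _ do rewrite mulr_sumr.
by rewrite pair_bigA; apply: eq_bigr => u _; rewrite mulrA.
Qed.

Lemma draw_law_sum1 t : \sum_u draw_law t u = 1.
Proof.
have := draw_law_sum t (fun _ _ => 1).
under eq_bigr => u _ do rewrite mulr1; move=> ->.
under eq_bigr => A _.
  under eq_bigr => B _ do rewrite mulr1.
  rewrite J_sum1 mulr1; over.
exact: pmf_sum1.
Qed.

Lemma coherent_run x0 eta a t : coherent fs (run fs S x0 eta (T := T) a t).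
Proof. by elim: t => [//|t IH]; apply: coherent_step. Qed.

(** The expected Lyapunov value starts at [f x0], the initial spread being [0],
    and never falls below the minimum of [f]; the drift accounts for the
    difference. *)
Lemma mean_grad_sum (eta c beta : R) (x0 xstar : 'rV[R]_N)
    (M := \sum_i weight S v L i)
    (G := fun a t => grad (favg fs) (iterate (run fs S x0 eta (T := T) a t))) :
  (forall x, favg fs xstar <= favg fs x) ->
  0 <= eta -> 0 <= c -> 0 < beta -> theta <= 1 ->
  avg L / 2 * eta ^+ 2 + c * M * eta ^+ 2
    + c * (1 - theta) * (1 + eta * beta) <= c ->
  avg L / 2 * eta ^+ 2 + c * M * eta ^+ 2
    + c * (1 - theta) * (eta * M / beta) <= eta / 2 ->
  eta / 2 * \sum_(t < T) \sum_a path_weight draw_law a * dot (G a t) (G a t)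
    <= favg fs x0 - favg fs xstar.
Proof.
move=> xmin eta0 c0 beta0 theta1 absorb_spread absorb_grad.
pose E (F : {ffun 'I_T -> {set 'I_n} * {set 'I_n}} -> R) :=
  \sum_a path_weight draw_law a * F a.
pose Phi a t := lyapunov fs S v L c (run fs S x0 eta (T := T) a t).
have E_cst r : E (fun=> r) = r.
  by rewrite /E -mulr_suml path_weight_sum1 ?mul1r //; apply: draw_law_sum1.
have E_le F F' : (forall a, F a <= F' a) -> E F <= E F'.
  move=> FF; apply: ler_sum => a _.
  by rewrite ler_wpM2l ?path_weight_ge0 //; apply: draw_law_ge0.
have drift (t : 'I_T) :
    E (Phi^~ t.+1) + eta / 2 * E (fun a => dot (G a t) (G a t))
      <= E (Phi^~ t).
  rewrite {1}/E (resample draw_law_sum1 t) -lerBrDr.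
  rewrite /E mulr_sumr -sumrB; apply: ler_sum => a _.
  rewrite (mulrCA (eta / 2)) -mulrBr ler_wpM2l ?path_weight_ge0 //.
    exact: draw_law_ge0.
  under eq_bigr => u _ do rewrite /Phi run_update.
  rewrite (draw_law_sum t (fun A B =>
    lyapunov _ _ _ _ _ (saga_step fs S eta A B (run fs S x0 eta a t)))).
  apply: (lyapunov_drift _ _ _ _ _ (J_sum1 t) (J_marginal t))
    absorb_spread absorb_grad => //.
  exact: coherent_run.
have tele k : (k <= T)%N ->
    E (Phi^~ k) + eta / 2 * \sum_(t < k) E (fun a => dot (G a t) (G a t))
      <= favg fs x0.
  elim: k => [_|k IH kT].
    rewrite big_ord0 mulr0 addr0 (_ : Phi^~ 0%N = fun=> favg fs x0) ?E_cst //.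
    apply/funext => a; rewrite /Phi /run /= /lyapunov /spread big1 /=.
      by rewrite mulr0 addr0.
    by move=> i _; rewrite subrr dot0r mulr0.
  apply: le_trans (IH (ltnW kT)); rewrite big_ord_recr /= mulrDr.
  have := drift (Ordinal kT); rewrite /=; lra.
have := tele T (leqnn T).
have : favg fs xstar <= E (Phi^~ T).
  rewrite -[leLHS]E_cst; apply: E_le => a.
  apply: le_trans (xmin (iterate (run fs S x0 eta a T))) _.
  rewrite /Phi /lyapunov lerDl mulr_ge0 //; exact: spread_ge0.
rewrite /E; lra.
Qed.

End Telescoping.

(** * Random elements of a finite type *)

Section FiniteRandomElement.
Context {R : realType} {disp : measure_display} {Omega : measurableType disp}.
Variable P : probability Omega R.

(** A function of [Y] is the combination, with its values as coefficients, of
    the indicators of the fibres of [Y]. *)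
Lemma expectation_finite (Z : finType) (Y : Omega -> Z) (h : Z -> R) :
  (forall z, measurable [set w | Y w = z]) -> (forall z, 0 <= h z) ->
  ('E_P[fun w => h (Y w)] = \sum_z (h z)%:E * P [set w | Y w = z])%E.
Proof.
move=> mY h0; rewrite unlock.
transitivity (\int[P]_w (\sum_z (h z)%:E * (\1_[set w | Y w = z] w)%:E))%E.
  apply: eq_integral => w _; rewrite (bigD1 (Y w)) //= indicE mem_set // mule1.
  rewrite big1 ?adde0 // => z zY; rewrite indicE memNset ?mule0 //=.
  by apply/eqP; rewrite eq_sym.
have mI z : measurable_fun setT (fun w => (\1_[set w | Y w = z] w : R)%:E).
  by apply/measurable_EFinP; apply: measurable_indic.
rewrite ge0_integral_sum //.
- apply: eq_bigr => z _; rewrite ge0_integralZl ?lee_fin ?h0 //.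
  by rewrite integral_indic ?setIT.
- by move=> z; apply: emeasurable_funM => //; apply: measurable_cst.
- by move=> z w _; apply: mule_ge0; rewrite lee_fin ?h0 ?indicE ?ler0n.
Qed.

Lemma probability_finite (Z : finType) (Y : Omega -> Z) (Q : pred Z) :
  (forall z, measurable [set w | Y w = z]) ->
  (P [set w | Q (Y w)] = \sum_(z | Q z) P [set w | Y w = z])%E.
Proof.
move=> mY.
have E : [set w | Q (Y w)] = \bigcup_(z in [set` enum Q]) [set w | Y w = z].
  apply/seteqP; split => [w /= QY|w /= [z /= + ->]]; last by rewrite mem_enum.
  by exists (Y w) => //=; rewrite mem_enum.
rewrite E measure_fin_bigcup //; first by rewrite -fsbig_seq ?enum_uniq // big_enum.
by move=> z z' _ _ [w /= [-> ->]].
Qed.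

End FiniteRandomElement.

(** * The law of the history of draws *)

Section Draws.
Context {R : realType} {n T : nat} {S : sampling R n} {d : R}.
Context {disp : measure_display} {Omega : measurableType disp}.
Variables (P : probability Omega R) (D : saga_draws S d T P).

Definition lawJ (t : 'I_T) (B : {set 'I_n}) : R :=
  fine (P [set w | drawJ D t w = B]).

Lemma lawJ_ge0 t B : 0 <= lawJ t B.
Proof. exact: fine_ge0. Qed.

Lemma lawJE (t : 'I_T) B : (P [set w | drawJ D t w = B] = (lawJ t B)%:E)%E.
Proof.
rewrite fineK // fin_num_measure //.
exact: (measurable_drawJ D).
Qed.

Lemma lawJ_sum1 t : \sum_B lawJ t B = 1.
Proof.
apply: EFin_inj; rewrite -sumEFin; under eq_bigr => B _ do rewrite -lawJE.
rewrite -(probability_finite _ xpredT) => [|B]; last exact: (measurable_drawJ D).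
by rewrite -(probability_setT P); congr (P _); apply/seteqP.
Qed.

Lemma lawJ_marginal t j : \sum_(B : {set 'I_n} | j \in B) lawJ t B = d / n%:R.
Proof.
apply: EFin_inj; rewrite -sumEFin; under eq_bigr => B _ do rewrite -lawJE.
rewrite -(probability_finite _ (fun B : {set 'I_n} => j \in B)) => [|B].
  exact: (law_drawJ D).
exact: (measurable_drawJ D).
Qed.

Definition history (w : Omega) :
    {ffun 'I_T -> {set 'I_n} * {set 'I_n}} * 'I_T :=
  ([ffun t : 'I_T => (drawS D t w, drawJ D t w)], drawI D w).

Lemma history_fibre z : [set w | history w = z] =
  [set w | [/\ forall t : 'I_T, drawS D t w \in [set (z.1 t).1]%SET,
             forall t : 'I_T, drawJ D t w \in [set (z.1 t).2]%SET &
             drawI D w \in [set z.2]%SET]].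
Proof.
case: z => a i; apply/seteqP; split => w /=.
  by case=> <- <-; split => [t|t|]; rewrite ?ffunE finset.inE.
case=> HS HJ; rewrite finset.inE => /eqP HI; congr (_, _) => //.
apply/ffunP => t; rewrite ffunE [RHS]surjective_pairing.
by have := HS t; have := HJ t; rewrite !finset.inE => /eqP -> /eqP ->.
Qed.

Lemma measurable_history z : measurable [set w | history w = z].
Proof.
rewrite (_ : [set w | history w = z] = \bigcap_(t in [set: 'I_T])
  ([set w | drawS D t w = (z.1 t).1] `&` [set w | drawJ D t w = (z.1 t).2])
   `&` [set w | drawI D w = z.2]).
  apply: measurableI; last exact: (measurable_drawI D).
  apply: fin_bigcap_measurable => // t _; apply: measurableI.
    exact: (measurable_drawS D).
  exact: (measurable_drawJ D).
rewrite history_fibre; apply/seteqP; split => w /=.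
  case=> HS HJ; rewrite finset.inE => /eqP HI; split => // t _.
  by split; [have := HS t | have := HJ t]; rewrite finset.inE => /eqP.
case=> HH ->; split => [t|t|]; rewrite finset.inE //;
  by have [/= eqS eqJ] := HH t I; rewrite ?eqS ?eqJ.
Qed.

Lemma law_history z : (P [set w | history w = z] =
  (path_weight (draw_law S lawJ) z.1 / T%:R)%:E)%E.
Proof.
rewrite history_fibre indep_draws.
have single (Y : Type) (Z : finType) (f : Y -> Z) a :
    [set y | f y \in [set a]%SET] = [set y | f y = a].
  by apply/seteqP; split => y /=; rewrite finset.inE => /eqP.
rewrite single law_drawI.
under eq_bigr => t _ do rewrite single (law_drawS D) //.
under [X in (_ * X * _)%E]eq_bigr => t _ do rewrite single lawJE.
have prodE (F : 'I_T -> R) : (\prod_t (F t)%:E = (\prod_t F t)%:E)%E.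
  by elim/big_rec2: _ => // i x y _ ->.
by rewrite !prodE -!EFinM -big_split.
Qed.

(** The output depends only on the history, so its mean is a finite sum against
    the product law, in which the uniform index turns into an average over the
    iterations. *)
Lemma mean_sq_grad_output (N : nat) (fs : 'I_n -> 'rV[R]_N -> R) x0 eta
    (f : 'rV[R]_N -> R)
    (g := fun a t => grad f (iterate (run fs S x0 eta a t))) :
  (mean_sq_grad f P (saga_output fs x0 eta D) =
    ((\sum_(t < T) \sum_a
         path_weight (draw_law S lawJ) a * dot (g a t) (g a t)) / T%:R)%:E)%E.
Proof.
pose h (z : {ffun 'I_T -> {set 'I_n} * {set 'I_n}} * 'I_T) :=
  dot (g z.1 z.2) (g z.1 z.2).
have -> : mean_sq_grad f P (saga_output fs x0 eta D) =
    ('E_P[fun w => h (history w)])%E.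
  rewrite /mean_sq_grad; congr ('E_P[_])%E; apply/funext => w.
  rewrite l2norm_sqr /h /g /run /saga_output /=.
  have -> : saga fs S x0 eta (drawS D ^~ w) (drawJ D ^~ w) (drawI D w) =
      saga fs S x0 eta (fun k => (draw_at (history w).1 k).1)
        (fun k => (draw_at (history w).1 k).2) (drawI D w) => [|//].
  by apply: eq_saga => k kI;
    rewrite -[k]/(val (Ordinal (ltn_trans kI (ltn_ord _)))) draw_at_ord ffunE.
rewrite expectation_finite => [|z|z]; last 2 first.
- exact: measurable_history.
- exact: dot_ge0.
under eq_bigr => z _ do rewrite law_history -EFinM.
rewrite sumEFin; congr EFin.
rewrite mulr_suml -(pair_bigA _ (fun a t =>
  h (a, t) * (path_weight (draw_law S lawJ) a / T%:R))) exchange_big /=.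
apply: eq_bigr => t _; rewrite mulr_suml; apply: eq_bigr => a _.
by rewrite mulrCA mulrA.
Qed.

End Draws.

(** * The choice of the constants *)

Section StepSize.
Context {R : realType}.

(** The parameters are tuned so that each quantity in the two conditions is a
    fixed multiple of another: [eta * beta = theta / 2] leaves half of the
    contraction, [c * theta = 2 * l * eta ^+ 2] makes this half twice the
    descent error [l / 2 * eta ^+ 2], and [c * M <= l / 8] and
    [l * eta <= 1 / 4] keep the remaining terms below the gain [eta / 2]. *)
Lemma step_size_conditions (l a r : R) (eta := r / (4 * l * a ^+ 2))
    (c := r / (8 * a * l)) (beta := 2 * l / a) (M := l ^+ 2 / r)
    (theta := r / a ^+ 3) :
  0 < l -> 1 <= a -> 0 < r -> r <= a ^+ 2 ->
  [/\ theta <= 1,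
      l / 2 * eta ^+ 2 + c * M * eta ^+ 2
        + c * (1 - theta) * (1 + eta * beta) <= c &
      l / 2 * eta ^+ 2 + c * M * eta ^+ 2
        + c * (1 - theta) * (eta * M / beta) <= eta / 2].
Proof.
move=> l0 a1 r0 ra.
have a0 : 0 < a by apply: lt_le_trans a1.
have ln : l != 0 by rewrite gt_eqF.
have an : a != 0 by rewrite gt_eqF.
have rn : r != 0 by rewrite gt_eqF.
have eta0 : 0 < eta by rewrite divr_gt0 ?mulr_gt0 ?exprn_gt0.
have c0 : 0 < c by rewrite divr_gt0 ?mulr_gt0.
have theta0 : 0 < theta by rewrite divr_gt0 ?exprn_gt0.
have theta1 : theta <= 1.
  rewrite ler_pdivrMr ?exprn_gt0 // mul1r (le_trans ra) //.
  by rewrite ler_weXn2l.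
have cM : c * M <= l / 8.
  have -> : c * M = l / 8 / a by rewrite /c /M; field; rewrite ln an rn.
  by rewrite ler_pdivrMr // ler_peMr // divr_ge0 // ltW.
have eta_beta : eta * beta = theta / 2.
  by rewrite /eta /beta /theta; field; rewrite ln an.
have c_theta : c * theta = 2 * l * eta ^+ 2.
  by rewrite /eta /c /theta; field; rewrite ln an.
have cMbeta : c * (eta * M / beta) = eta / 16.
  by rewrite /c /M /beta; field; rewrite ln an rn.
have leta : l * eta <= 1 / 4.
  have -> : l * eta = r / a ^+ 2 / 4 by rewrite /eta; field; rewrite ln an.
  by rewrite ler_pM2r // ler_pdivrMr ?exprn_gt0 // mul1r.
have M_eta2 := ler_wpM2r (sqr_ge0 eta) cM.
have l_eta2 : l * eta ^+ 2 <= eta / 4.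
  by rewrite expr2 mulrA; have := ler_wpM2r (ltW eta0) leta; lra.
clearbody eta c beta M theta; split => //.
  rewrite eta_beta; have := mulr_ge0 (ltW c0) (sqr_ge0 theta); nra.
have -> : c * (1 - theta) * (eta * M / beta) = (1 - theta) * (eta / 16).
  by rewrite -cMbeta; ring.
by have := mulr_ge0 (ltW theta0) (ltW eta0); lra.
Qed.

Lemma exists_iterations (C q : R) : 0 <= C -> 0 < q ->
  exists2 T : nat, (0 < T)%N & C <= T%:R * q <= C + q.
Proof.
move=> C0 q0; exists (Num.truncn (C / q)).+1 => //.
have Cq : 0 <= C / q by rewrite divr_ge0 // ltW.
have /andP[le lt] := truncn_itv Cq.
rewrite -ler_pdivrMr // ltW //=.
have -> : C + q = (C / q + 1) * q by rewrite mulrDl mul1r divfK ?gt_eqF.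
by rewrite ler_pM2r // -natr1 lerD2r.
Qed.

End StepSize.

Lemma sum_weight (R : realType) (n : nat) (S : sampling R n) (v L : 'I_n -> R) :
  0 < avg_size S -> avg L != 0 ->
  \sum_i weight S v L i = alphaconst S v L * avg L ^+ 2 / avg_size S.
Proof.
move=> b0 l0; rewrite /alphaconst /Kconst divfK ?sqrf_eq0 //.
rewrite [in RHS]mulrAC [X in X * _]mulrAC divff ?gt_eqF // mul1r mulr_sumr.
by apply: eq_bigr => i _; rewrite /weight invfM mulrCA mulrC.
Qed.

Lemma avg_size_gt0 (R : realType) (n : nat) (S : sampling R n) :
  (0 < n)%N -> proper_sampling S -> 0 < avg_size S.
Proof.
case: n S => // n S _ Sp; rewrite avg_sizeE big_ord_recl ltr_pwDl //.
by apply: sumr_ge0 => i _; rewrite ltW.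
Qed.

Lemma cube_root_nat (R : realType) (n : nat) : (0 < n)%N ->
  exists2 a : R, 1 <= a & n%:R = a ^+ 3 /\ n%:R `^ (2%:R / 3%:R) = a ^+ 2.
Proof.
move=> n0; pose a : R := n%:R `^ (3^-1).
have ak k : a ^+ k = n%:R `^ (k%:R / 3).
  by rewrite -powR_mulrn ?powR_ge0 // -powRrM mulrC.
have a3 : a ^+ 3 = n%:R by rewrite ak divff ?pnatr_eq0 // powRr1.
exists a; last by rewrite a3 -ak.
by rewrite -(@ler_pXn2r _ 3) ?nnegrE ?powR_ge0 // expr1n a3 ler1n.
Qed.

(** * The convergence rate *)

Lemma saga_rate (R : realType) (N n : nat) (fs : 'I_n -> 'rV[R]_N -> R)
    (L : 'I_n -> R) (xstar x0 : 'rV[R]_N) (S : sampling R n) (v : 'I_n -> R)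
    (T : nat) (disp : measure_display) (Omega : measurableType disp)
    (P : probability Omega R)
    (b := avg_size S) (alpha := alphaconst S v L)
    (n23 := n%:R `^ (2%:R / 3%:R))
    (D : saga_draws S (b / alpha) T P) :
  (forall i x, differentiable (fs i) x) ->
  (forall i, smooth (L i) (fs i)) ->
  (forall x, favg fs xstar <= favg fs x) ->
  0 < avg L -> proper_sampling S -> eso S v ->
  0 < b -> 0 < alpha -> b <= alpha * n23 -> (0 < T)%N ->
  (mean_sq_grad (favg fs) P
      (saga_output fs x0 (b / (4 * alpha * avg L * n23)) D) <=
    (alpha * avg L * n23 * (favg fs x0 - favg fs xstar)
       / (b * T%:R * 8^-1))%:E)%E.
Proof.
move=> fd fsm xmin l0 Sp Se b0 alpha0 br T0.
have n0 : (0 < n)%N by rewrite -(ltr0n R); apply: n_gt0 l0.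
have [a a1 [na n23a]] := cube_root_nat R n0.
have a0 : 0 < a by apply: lt_le_trans a1.
have r0 : 0 < b / alpha by rewrite divr_gt0.
have ra : b / alpha <= a ^+ 2 by rewrite ler_pdivrMr // mulrC -n23a.
have [theta1 C1 C2] := step_size_conditions l0 a1 r0 ra.
have M_E : \sum_i weight S v L i = avg L ^+ 2 / (b / alpha).
  rewrite sum_weight ?gt_eqF // -/alpha -/b.
  have swap (x y z : R) : x * y / z = y / (z / x).
    by rewrite invf_div mulrA (mulrC y).
  exact: swap.
rewrite -M_E in C1 C2.
set eta := b / (4 * alpha * avg L * n23).
have eta_E : b / alpha / (4 * avg L * a ^+ 2) = eta.
  by rewrite /eta /n23 n23a; field; rewrite !gt_eqF.
rewrite eta_E in C1 C2.
have eta0 : 0 < eta.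
  have al0 : 0 < 4 * avg L by rewrite mulr_gt0.
  by rewrite -eta_E; apply: divr_gt0 => //; rewrite mulr_gt0 ?exprn_gt0.
have marg (t : 'I_T) j :
    \sum_(B : {set 'I_n} | j \in B) lawJ D t B = b / alpha / a ^+ 3.
  by rewrite lawJ_marginal na.
have c0 : 0 <= b / alpha / (8 * a * avg L).
  by apply: divr_ge0; rewrite ltW // mulr_gt0 // mulr_gt0.
have beta0 : 0 < 2 * avg L / a by apply: divr_gt0 => //; rewrite mulr_gt0.
rewrite mean_sq_grad_output lee_fin.
have := mean_grad_sum fd fsm l0 Sp Se (lawJ_ge0 D) (lawJ_sum1 D) marg x0 xmin
  (ltW eta0) c0 beta0 theta1 C1 C2.
set G := \sum_(t < T) _ => bound.
have T0R : 0 < T%:R :> R by rewrite ltr0n.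
have -> : alpha * avg L * n23 * (favg fs x0 - favg fs xstar)
      / (b * T%:R * 8^-1)
   = (favg fs x0 - favg fs xstar) / (eta / 2) / T%:R.
  rewrite -eta_E /n23 n23a; field; by rewrite !gt_eqF.
have half : 0 < eta / 2 by apply: divr_gt0.
by rewrite ler_pM2r ?invr_gt0 // ler_pdivlMr // [leLHS]mulrC.
Qed.

Theorem theorem4 (R : realType) :
  exists mu3 nu3 : R, [/\ 0 < mu3, 0 < nu3, nu3 < 1 &
  forall (N n : nat) (fs : 'I_n -> 'rV[R]_N -> R) (L : 'I_n -> R)
    (xstar x0 : 'rV[R]_N) (S : sampling R n) (v : 'I_n -> R),
  (forall i x, differentiable (fs i) x) ->
  (forall i, smooth (L i) (fs i)) ->
  (forall x, favg fs xstar <= favg fs x) ->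
  0 < avg L ->
  proper_sampling S ->
  eso S v ->
  let f := favg fs in
  let b := avg_size S in
  let alpha := alphaconst S v L in
  let n23 := n%:R `^ (2%:R / 3%:R) in
  let eta := b / (mu3 * alpha * avg L * n23) in
  let d := b / alpha in
  b <= alpha * n23 ->
  (forall (T : nat) (disp : measure_display) (Omega : measurableType disp)
     (P : probability Omega R) (D : saga_draws S d T P),
     (0 < T)%N ->
     (mean_sq_grad f P (saga_output fs x0 eta D) <=
       (alpha * avg L * n23 * (f x0 - f xstar) / (b * T%:R * nu3))%:E)%E) /\
  (forall eps : R, 0 < eps ->
     let evals :=
       n%:R + avg L * n23 * (f x0 - f xstar) / (eps * nu3) * (1 + alpha) in
     (forall (T : nat) (disp : measure_display) (Omega : measurableType disp)
        (P : probability Omega R) (D : saga_draws S d T P),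
        (0 < T)%N -> evals <= saga_evals n d b T ->
        eps_accurate f eps P (saga_output fs x0 eta D)) /\
     (exists2 T : nat, (0 < T)%N &
        evals <= saga_evals n d b T <= evals + (d + b)))].
Proof.
exists 4, 8^-1; split=> [|||
  N n fs L xstar x0 S v fd fsm xmin l0 Sp Se f b alpha n23 eta d br].
- by [].
- by rewrite invr_gt0.
- by rewrite invf_lt1 // ltr1n.
have n0 : (0 < n)%N by rewrite -(ltr0n R); apply: n_gt0 l0.
have b0 : 0 < b by exact: avg_size_gt0.
have n23_ge0 : 0 <= n23 by exact: powR_ge0.
(* The bound on the batch size forces [alpha] to be positive. *)
have alpha0 : 0 < alpha.
  rewrite ltNge; apply/negP => alpha_le0.
  have := lt_le_trans b0 br; rewrite ltNge => /negP; apply.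
  by rewrite mulr_le0_ge0.
have rate (T : nat) (disp : measure_display) (Omega : measurableType disp)
     (P : probability Omega R) (D : saga_draws S d T P) : (0 < T)%N ->
     (mean_sq_grad f P (saga_output fs x0 eta D) <=
       (alpha * avg L * n23 * (f x0 - f xstar) / (b * T%:R * 8^-1))%:E)%E.
  by move=> T0; apply: saga_rate.
split=> // eps eps0 evals.
have db : d + b = b / alpha * (1 + alpha) by rewrite /d mulrDr mulr1 divfK ?gt_eqF.
have alpha1 : 0 < 1 + alpha by rewrite addr_gt0.
split=> [T disp Omega P D T0 | ]; last first.
  have C0 : 0 <= avg L * n23 * (f x0 - f xstar) / (eps * 8^-1) * (1 + alpha).
    have gap : 0 <= f x0 - f xstar by rewrite subr_ge0.
    have num : 0 <= avg L * n23 * (f x0 - f xstar).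
      by apply: mulr_ge0 => //; apply: mulr_ge0 => //; apply: ltW.
    have den : 0 <= eps * 8^-1 by rewrite mulr_ge0 ?invr_ge0 // ltW.
    by apply: mulr_ge0; [apply: divr_ge0 | apply: ltW].
  have db0 : 0 < d + b by rewrite db; apply: mulr_gt0 => //; apply: divr_gt0.
  have [T T0 /andP[le1 le2]] := exists_iterations C0 db0.
  by exists T => //; rewrite /evals /saga_evals -addrA !lerD2l le1.
rewrite /evals /saga_evals lerD2l db mulrA ler_pM2r // => enough.
apply: le_trans (rate _ _ _ _ D T0) _; rewrite lee_fin.
have T0R : 0 < T%:R :> R by rewrite ltr0n.
have -> : alpha * avg L * n23 * (f x0 - f xstar) / (b * T%:R * 8^-1)
    = avg L * n23 * (f x0 - f xstar) / (eps * 8^-1) / (T%:R * (b / alpha)) * eps.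
  by field; rewrite !gt_eqF.
have step0 : 0 < T%:R * (b / alpha) by apply: mulr_gt0 => //; apply: divr_gt0.
by rewrite ler_piMl ?(ltW eps0) // ler_pdivrMr // mul1r.
Qed.
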